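(* The space $\mathrm{Specm}(\mathrm{Reg}^\circ([0,1],\mathbb{R}))$ is a profinite space.
   Context: $\mathrm{Reg}([0,1],\mathbb{R})$ is the ring (pointwise operations) of all functions $f:[0,1]\to\mathbb{R}$ such that $f(c+)=\lim_{x\to c,\,x>c}f(x)$ exists in $\mathbb{R}$ for every $c\in[0,1)$ and $f(c-)=\lim_{x\to c,\,x<c}f(x)$ exists in $\mathbb{R}$ for every $c\in(0,1]$. $\mathrm{Reg}^\circ([0,1],\mathbb{R})$ is the subring of those functions with only finitely many discontinuities. For a commutative ring $R$, $\mathrm{Specm}(R)$ is the set of maximal ideals with the subspace topology induced from the Zariski topology on $\mathrm{Spec}(R)$. A profinite space is a compact Hausdorff totally disconnected space. *)

(* Defs.v *)
From HB Require Import structures.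
From mathcomp Require Import all_boot all_order all_algebra.
From mathcomp Require Import all_classical all_reals all_analysis.

Set Implicit Arguments.
Unset Strict Implicit.
Unset Printing Implicit Defensive.

Import Order.TTheory GRing.Theory Num.Theory.
Import numFieldNormedType.Exports.

Local Open Scope classical_set_scope.
Local Open Scope ring_scope.

(* [idealr_closed] includes properness: it requires that 1 not be a member. *)
Definition prime_ideal (A : comNzRingType) (P : set A) : Prop :=
  idealr_closed [in P] /\ prime_idealr_closed [in P].

Definition maximal_ideal (A : comNzRingType) (M : set A) : Prop :=
  idealr_closed [in M] /\
  forall J : set A, idealr_closed [in J] -> M `<=` J -> J = M.

Lemma maximal_ideal_prime (A : comNzRingType) (M : set A) :
  maximal_ideal M -> prime_ideal M.
Proof.
move=> [[M0 M1 MD] Mmax]; split; first by [].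
move=> u v; rewrite /= => Muv; case: (boolP (u \in M)) => //= Mu.
pose J : set A := [set x | exists a m, m \in M /\ x = a * u + m].
have MJ : M `<=` J by move=> m Mm; exists 0, m; rewrite mul0r add0r inE.
have Ju : J u by exists 1, 0; rewrite mul1r addr0.
have [J1|NJ1] := pselect (J 1).
  have [a [m [Mm e]]] := J1.
  have -> : v = a * (u * v) + (v * m + 0).
    by rewrite -[LHS]mul1r e mulrDl addr0 mulrA [m * v]mulrC.
  exact: MD Muv (MD v _ _ Mm M0).
suff JM : J = M by move: Mu; rewrite -JM => /negP; rewrite inE => /(_ Ju).
apply: Mmax => //; split.
- by rewrite /= inE; exact: MJ (set_mem M0).
- by apply/negP => /=; rewrite inE.
- move=> a x y /=; rewrite !inE => -[b [m [Mm ->]]] [c [n [Mn ->]]].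
  exists (a * b + c), (a * m + n); split; first exact: MD.
  by rewrite mulrDr mulrDl !mulrA addrACA.
Qed.

Definition Spec (A : comNzRingType) : Type := 
  set_type [set P : set A | prime_ideal P].

HB.instance Definition _ (A : comNzRingType) := Choice.on (Spec A).

Definition zariski_closed (A : comNzRingType) (S : set A) : set (Spec A) :=
  [set P : Spec A | S `<=` val P].

Definition zariski_open (A : comNzRingType) : set_system (Spec A) :=
  [set U | exists S : set A, U = ~` zariski_closed S].

Section zariski_topology.
Variable A : comNzRingType.

Let prime_val (P : Spec A) : prime_ideal (val P).
Proof. exact: (set_mem (valP P)). Qed.

Let zariski_openT : zariski_open [set: Spec A].
Proof.
exists setT; apply/esym/seteqP; split => // P _ /= /(_ 1 I) P1.
by have [[_ /negP + _] _] := prime_val P; rewrite /= inE.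
Qed.

Let zariski_openI : setI_closed (@zariski_open A).
Proof.
move=> _ _ [S ->] [S' ->].
exists [set x | exists a b, [/\ S a, S' b & x = a * b]].
apply/seteqP; split => P /=.
- move=> [/existsNP[a /not_implyP[Sa Pa]] /existsNP[b /not_implyP[Sb Pb]]] H.
  have Pab : val P (a * b) by apply: H; exists a, b.
  have [_ /(_ a b)] := prime_val P.
  by rewrite /= !inE => /(_ Pab); case/orP; rewrite inE.
- move=> H; have [[P0 _ PD] _] := prime_val P.
  split=> SP; apply: H => _ [a [b [Sa Sb ->]]]; apply/set_mem.
  + by rewrite mulrC -[_ * _]addr0; apply: PD => //; exact/mem_set/SP.
  + by rewrite -[_ * _]addr0; apply: PD => //; exact/mem_set/SP.
Qed.

Let zariski_open_bigU (J : Type) (f : J -> set (Spec A)) :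
  (forall j, zariski_open (f j)) -> zariski_open (\bigcup_j f j).
Proof.
move=> fo.
exists [set a | exists j, forall P, ~ val P a -> f j P].
apply/seteqP; split => P /=.
- move=> [j _ fjP] H; have [S fS] := fo j.
  move: (fjP); rewrite fS => /= /existsNP[a /not_implyP[Sa Pa]].
  by apply: Pa; apply: H; exists j => Q Qa; rewrite fS => /(_ a Sa).
- by move=> /existsNP[a /not_implyP[[j Hj] Pa]]; exists j => //; exact: Hj.
Qed.

HB.instance Definition _ := isOpenTopological.Build (Spec A)
  zariski_openT zariski_openI zariski_open_bigU.

End zariski_topology.

(* By [maximal_ideal_prime], the points are all the maximal ideals of A. As a
   type, a set of points of a topological space carries the subspace topology. *)
Definition Specm (A : comNzRingType) : set (Spec A) :=
  [set P : Spec A | maximal_ideal (val P)].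
Arguments Specm : clear implicits.

Definition profinite_space (T : topologicalType) : Prop :=
  [/\ compact [set: T], hausdorff_space T & totally_disconnected [set: T]].

Definition unit_itv (R : realType) : set R := `[0, 1]%classic.
Arguments unit_itv : clear implicits.

Section regulated_ring.
Variable R : realType.
Implicit Types f g : unit_itv R -> R.

(* The neighbourhood filters are those of the subspace [0, 1], so the limits
   are taken over points of [0, 1] only. *)
Definition has_right_lim f (c : unit_itv R) : Prop :=
  exists l : R,
    f x @[x --> within [set x | val c < val x] (nbhs c)] --> l.

Definition has_left_lim f (c : unit_itv R) : Prop :=
  exists l : R,
    f x @[x --> within [set x | val x < val c] (nbhs c)] --> l.

Definition regulated f : Prop :=
  (forall c : unit_itv R, val c < 1 -> has_right_lim f c) /\
  (forall c : unit_itv R, 0 < val c -> has_left_lim f c).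

Definition discontinuities f : set (unit_itv R) :=
  [set c | ~ {for c, continuous f}].

Definition Reg_circ_pred : {pred unit_itv R -> R} :=
  fun f => `[< regulated f /\ finite_set (discontinuities f) >].

Lemma Reg_circ_subring : subring_closed Reg_circ_pred.
Proof.
split.
- apply/asboolP; split.
    by split=> c _; exists 1; exact: cvg_cst.
  rewrite (_ : discontinuities _ = set0) //.
  by apply/seteqP; split => // c /=; apply; exact: cst_continuous.
- move=> f g /asboolP[[fr fl] fd] /asboolP[[gr gl] gd]; apply/asboolP; split.
    split=> c hc.
    + have [a fa] := fr c hc; have [b gb] := gr c hc.
      by exists (a - b); exact: cvgB fa gb.
    + have [a fa] := fl c hc; have [b gb] := gl c hc.
      by exists (a - b); exact: cvgB fa gb.
  apply: (@sub_finite_set _ _ (discontinuities f `|` discontinuities g)).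
    move=> c /= Nc; apply: contrapT => /not_orP[/contrapT cf /contrapT cg].
    by apply: Nc; exact: cvgB cf cg.
  by rewrite finite_setU.
- move=> f g /asboolP[[fr fl] fd] /asboolP[[gr gl] gd]; apply/asboolP; split.
    split=> c hc.
    + have [a fa] := fr c hc; have [b gb] := gr c hc.
      by exists (a * b); exact: cvgM fa gb.
    + have [a fa] := fl c hc; have [b gb] := gl c hc.
      by exists (a * b); exact: cvgM fa gb.
  apply: (@sub_finite_set _ _ (discontinuities f `|` discontinuities g)).
    move=> c /= Nc; apply: contrapT => /not_orP[/contrapT cf /contrapT cg].
    by apply: Nc; exact: cvgM cf cg.
  by rewrite finite_setU.
Qed.

Definition Reg_circ : Type := {f : unit_itv R -> R | f \in Reg_circ_pred}.

HB.instance Definition _ := SubChoice.on Reg_circ.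
HB.instance Definition _ :=
  GRing.SubChoice_isSubComPzRing.Build _ _ Reg_circ Reg_circ_subring.

Let Reg_circ_oner_neq0 : (1 : Reg_circ) != 0.
Proof.
have h0 : (0 : R) \in unit_itv R by rewrite inE /unit_itv /= in_itv /= lexx ler01.
apply/eqP => /(congr1 val) /(congr1 (fun f => f (exist _ 0 h0))).
by move/eqP; rewrite /= oner_eq0.
Qed.

HB.instance Definition _ :=
  GRing.PzSemiRing_isNonZero.Build Reg_circ Reg_circ_oner_neq0.

End regulated_ring.

(* Main.v *)
Require Import Defs.
From mathcomp Require Import all_boot all_order all_algebra.
From mathcomp Require Import all_classical all_reals all_analysis.
From mathcomp Require Import ring lra.

(** The ring [Reg_circ R] is clean: each element is the sum of an idempotent
    and a unit ([Reg_circ_clean]). The maximal spectrum of any clean ring is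
    profinite ([clean_specm_profinite]).

    Compactness holds for every commutative ring. For an ultrafilter F on
    Specm, the elements a such that F-almost all maximal ideals contain a form
    a proper ideal, and F converges to any maximal ideal above it.

    Cleanness gives the separation. For distinct maximal ideals P and Q choose
    b in P with 1 - b in Q, and write b = e + u with e idempotent and u a unit.
    Since u lies in no maximal ideal, e is not in P and 1 - e is not in Q, so e
    is in Q. The set of maximal ideals avoiding an idempotent is clopen, as its
    complement is the set avoiding 1 - e. Hence clopen sets separate points,
    and both Hausdorffness and total disconnectedness follow.

    For the cleanness of [Reg_circ R], the idempotents are the indicators of
    the sets E that are tame, meaning that the indicator is regulated with
    finitely many discontinuities. Given f, it is enough to find a tame E with
    f < 3/4 on E and 1/4 < f off E: then f - 1_E stays at distance at least 1/4
    from 0, so its pointwise inverse is again in the ring. A sublevel set of f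
    would not do, since even for continuous f it may have infinitely many
    boundary points. Instead, near each point c the one-sided limits cut a
    neighbourhood into {c} and two intervals on which f oscillates by less than
    1/2, so that each piece may be put wholly inside or wholly outside E.
    Separability passes to finite unions of pieces, because points where
    1/4 < f < 3/4 may lie on either side; so compactness of [0, 1] makes it
    global. *)

Set Implicit Arguments.
Unset Strict Implicit.
Unset Printing Implicit Defensive.

Import Order.TTheory GRing.Theory Num.Theory.
Import numFieldNormedType.Exports.

Local Open Scope classical_set_scope.
Local Open Scope ring_scope.

(** * Ideals of a commutative ring *)

Section ideals.
Variable A : comNzRingType.
Implicit Types (I M : set A) (a b e : A).

Lemma idealr_closed_setP I : idealr_closed [in I] <->
  [/\ I 0, ~ I 1 & forall a u v, I u -> I v -> I (a * u + v)].
Proof.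
split=> [[I0 I1 ID]|[I0 I1 ID]].
  split; first exact/set_mem.
    by move=> /mem_set; exact/negP.
  by move=> a u v /mem_set Iu /mem_set Iv; exact/set_mem/ID.
split; first exact/mem_set.
  by apply/negP => /set_mem.
by move=> a u v /set_mem Iu /set_mem Iv; exact/mem_set/ID.
Qed.

Section ideal_theory.
Variable I : set A.
Hypothesis idI : idealr_closed [in I].

Lemma ideal_mem0 : I 0.
Proof. by have [] := (idealr_closed_setP I).1 idI. Qed.

Lemma ideal_mem1N : ~ I 1.
Proof. by have [] := (idealr_closed_setP I).1 idI. Qed.

Lemma ideal_memD a b : I a -> I b -> I (a + b).
Proof.
have [_ _ + Ia Ib] := (idealr_closed_setP I).1 idI => /(_ 1 _ _ Ia Ib).
by rewrite mul1r.
Qed.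

Lemma ideal_memM a b : I b -> I (a * b).
Proof.
have [I0 _ + Ib] := (idealr_closed_setP I).1 idI => /(_ a _ _ Ib I0).
by rewrite addr0.
Qed.

Lemma ideal_memB a b : I a -> I b -> I (a - b).
Proof.
by move=> Ia Ib; apply: ideal_memD; rewrite // -mulN1r; apply: ideal_memM.
Qed.

Lemma ideal_unitN a b : a * b = 1 -> ~ I a.
Proof.
by move=> ab Ia; apply: ideal_mem1N; rewrite -ab mulrC; exact: ideal_memM.
Qed.

End ideal_theory.

(** Zorn's lemma is applied to the sets J for which I `|` J is a proper ideal,
    rather than to the proper ideals above I: the empty chain then needs no
    separate treatment, because its union set0 gives I itself. *)
Lemma exists_maximal_ideal I : idealr_closed [in I] ->
  exists2 M, maximal_ideal M & I `<=` M.
Proof.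
move=> idI.
have [|M [idM Mmax]] := @Zorn_bigcup A [set J | idealr_closed [in I `|` J]].
  move=> F Fid Ftot; apply/idealr_closed_setP; split.
  - by left; exact: ideal_mem0.
  - case=> [|[J FJ J1]]; first exact: ideal_mem1N.
    by apply: (ideal_mem1N (Fid _ FJ)); right.
  - have FU J u v a : F J -> (I `|` J) u -> (I `|` J) v ->
        (I `|` \bigcup_(X in F) X) (a * u + v).
      move=> FJ Ju Jv; have idJ := Fid _ FJ.
      have [Ia|Ja] := ideal_memD idJ (ideal_memM idJ a Ju) Jv; first by left.
      by right; exists J.
    move=> a u v [Iu|[J FJ Ju]] [Iv|[K FK Kv]].
    + by left; apply: ideal_memD => //; exact: ideal_memM.
    + by apply: (FU K) => //; [left|right].
    + by apply: (FU J) => //; [right|left].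
    + case: (Ftot _ _ FJ FK) => [JK|KJ].
      * by apply: (FU K) => //; right => //; exact: JK.
      * by apply: (FU J) => //; right => //; exact: KJ.
exists (I `|` M); last exact: subsetUl.
split=> // J idJ IMJ.
apply/seteqP; split=> // x Jx; right; apply: contrapT => Mx.
apply: (Mmax J).
  by split=> [y My|JM]; [apply: IMJ; right|apply: Mx; exact: JM].
have /setUidPr IJ : I `<=` J by move=> y Iy; apply: IMJ; left.
by rewrite /= IJ.
Qed.

(** If a is in M but not in N, then maximality of N makes N + (a) the whole
    ring; the multiple of a in a decomposition of 1 is the required b. *)
Lemma maximal_ideal_comaximal M N :
  maximal_ideal M -> maximal_ideal N -> M <> N ->
  exists2 b, M b & N (1 - b).
Proof.
move=> [idM Mmax] [idN Nmax] MN.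
have [a Ma Na] : exists2 a, M a & ~ N a.
  apply: contrapT => H; apply: MN; apply/esym/Mmax => // a Ma.
  by apply: contrapT => Na; apply: H; exists a.
pose J := [set x | exists2 r, N (x - r * a) & True].
have [J1|J1] := pselect (J 1).
  by have [r Nr _] := J1; exists (r * a) => //; exact: ideal_memM.
have NJ : N `<=` J by move=> x Nx; exists 0; rewrite // mul0r subr0.
suff JN : J = N.
  case: Na; rewrite -JN; exists 1 => //; rewrite mul1r subrr.
  exact: ideal_mem0.
apply: Nmax => //; apply/idealr_closed_setP; split=> //.
  by apply: NJ; exact: ideal_mem0.
move=> c u v [r Nr _] [s Ns _]; exists (c * r + s) => //.
have -> : c * u + v - (c * r + s) * a = c * (u - r * a) + (v - s * a) by ring.
by apply: ideal_memD => //; exact: ideal_memM.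
Qed.

Lemma prime_ideal_idem M e : prime_ideal M -> e * e = e -> M e \/ M (1 - e).
Proof.
move=> [idM prM] ee; have /mem_set : M (e * (1 - e)).
  by rewrite mulrBr mulr1 ee subrr; exact: ideal_mem0.
by move=> /prM /orP[] /set_mem; [left|right].
Qed.

End ideals.

(** * The maximal spectrum of a clean ring *)

Definition clean_ring (A : comNzRingType) : Prop :=
  forall a : A, exists e u : A, e * e = e /\ (a - e) * u = 1.

Section Specm.
Variable A : comNzRingType.

Definition specm_ideal (P : Specm A) : set A := val (val P).

Lemma specm_idealP (P : Specm A) : maximal_ideal (specm_ideal P).
Proof. exact: set_mem (valP P). Qed.

Lemma specm_ideal_closed (P : Specm A) : idealr_closed [in specm_ideal P].
Proof. by have [] := specm_idealP P. Qed.

Lemma specm_of_maximal (M : set A) : maximal_ideal M ->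
  exists P : Specm A, specm_ideal P = M.
Proof.
move=> maxM; have prM := mem_set (maximal_ideal_prime maxM).
have maxP : (exist _ M prM : Spec A) \in Specm A by exact: mem_set.
by exists (exist (fun Q => Q \in Specm A) _ maxP).
Qed.

Lemma specm_ideal_inj : injective specm_ideal.
Proof. by move=> P Q PQ; do 2 apply: val_inj. Qed.

Lemma open_specm_notin (a : A) : open [set P : Specm A | ~ specm_ideal P a].
Proof.
exists (~` zariski_closed [set a]); first by exists [set a].
apply/seteqP; split => P /= H; first by move=> Pa; apply: H => _ ->.
by move=> /(_ a erefl).
Qed.

(** The sets of ideals avoiding one element form a basis of the topology. *)
Lemma nbhs_specm_notin (P : Specm A) (U : set (Specm A)) : nbhs P U ->
  exists2 a, ~ specm_ideal P a & [set Q | ~ specm_ideal Q a] `<=` U.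
Proof.
rewrite nbhsE => -[V [[W [S ->] <-] PV] VU].
move: PV => /= /existsNP[a /not_implyP[Sa Pa]]; exists a => // Q Qa.
by apply: VU => /= SQ; apply: Qa; exact: SQ.
Qed.

(** The ideal I below is the limit of the ultrafilter in the prime spectrum; any
    maximal M above it is a limit in Specm, since an element outside M is
    outside I, so that almost all ideals avoid it. *)
Lemma compact_specm : compact [set: Specm A].
Proof.
rewrite compact_ultra => F FU _.
pose I : set A := [set a | F [set P : Specm A | specm_ideal P a]].
have idI : idealr_closed [in I].
  apply/idealr_closed_setP; split; rewrite /I /=.
  - by apply: filterE => P; exact: ideal_mem0 (specm_ideal_closed P).
  - move=> F1; apply: (@filter_not_empty _ F); apply: filterS F1 => P.
    exact: ideal_mem1N (specm_ideal_closed P).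
  - move=> a u v Fu Fv; apply: filterS2 Fu Fv => P Pu Pv.
    have idP := specm_ideal_closed P.
    by apply: ideal_memD => //; exact: ideal_memM.
have [M maxM IM] := exists_maximal_ideal idI.
have [P PM] := specm_of_maximal maxM.
exists P; split=> // U /nbhs_specm_notin[a]; rewrite PM => Ma aU.
apply: filterS aU _.
have [Fa|//] := in_ultra_setVsetC [set Q : Specm A | specm_ideal Q a] FU.
by case: Ma; exact: IM.
Qed.

Hypothesis cleanA : clean_ring A.

(** With b in P, 1 - b in Q and b - e a unit: e in P would put the unit b - e
    in P, and 1 - e in Q would put it in Q. *)
Lemma clean_separation (P Q : Specm A) : P <> Q ->
  exists e, [/\ e * e = e, ~ specm_ideal P e & specm_ideal Q e].
Proof.
move=> PQ; have idP := specm_ideal_closed P; have idQ := specm_ideal_closed Q.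
have [|b Pb Qb] := maximal_ideal_comaximal (specm_idealP P) (specm_idealP Q).
  by move=> /specm_ideal_inj.
have [e [u [ee eu]]] := cleanA b; exists e; split=> // [Pe|].
  by apply: (ideal_unitN idP eu); exact: ideal_memB.
have [//|Qe] := prime_ideal_idem (maximal_ideal_prime (specm_idealP Q)) ee.
case: (ideal_unitN idQ eu).
have -> : b - e = (1 - e) - (1 - b) by ring.
exact: ideal_memB.
Qed.

(** A prime ideal contains exactly one of e and 1 - e, so the complement is the
    open set of ideals avoiding 1 - e. *)
Lemma clopen_specm_idem (e : A) : e * e = e ->
  clopen [set P : Specm A | ~ specm_ideal P e].
Proof.
move=> ee; split; first exact: open_specm_notin.
rewrite -openC.
rewrite (_ : ~` _ = [set P : Specm A | ~ specm_ideal P (1 - e)]).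
  exact: open_specm_notin.
apply/seteqP; split => P /= Pe.
  move/contrapT: Pe => Pe Pe'; apply: (ideal_mem1N (specm_ideal_closed P)).
  by rewrite -(subrK e 1); apply: ideal_memD => //; exact: specm_ideal_closed.
have prP := maximal_ideal_prime (specm_idealP P).
by have [Pe1|/Pe] := prime_ideal_idem prP ee; first by apply.
Qed.

Lemma clean_specm_zero_dimensional : zero_dimensional (Specm A).
Proof.
move=> P Q /eqP /clean_separation[e [ee Pe Qe]].
exists [set P : Specm A | ~ specm_ideal P e]; split=> //.
exact: clopen_specm_idem.
Qed.

Theorem clean_specm_profinite : profinite_space (Specm A).
Proof.
split; first exact: compact_specm.
- rewrite open_hausdorff => P Q /clean_specm_zero_dimensional[U [[oU cU] PU QU]].
  exists (U, ~` U) => /=; first by split; apply/mem_set.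
  by split=> //; [exact: closed_openC | rewrite setICr].
- exact: zero_dimension_totally_disconnected clean_specm_zero_dimensional.
Qed.

End Specm.
(** * The unit interval as a topological space *)

Lemma sgr_subr_near (R : realDomainType) (a c x : R) :
  `|c - x| < `|c - a| -> Num.sg (x - a) = Num.sg (c - a).
Proof.
case: (ltgtP c a) => [ca|ca|->]; last by rewrite subrr normr0 normr_lt0.
  have ca0 : c - a < 0 by rewrite subr_lt0.
  rewrite (ltr0_norm ca0) (ltr0_sg ca0) => xc.
  by apply: ltr0_sg; move: xc; rewrite ltr_norml; lra.
have ca0 : 0 < c - a by rewrite subr_gt0.
rewrite (gtr0_norm ca0) (gtr0_sg ca0) => xc.
by apply: gtr0_sg; move: xc; rewrite ltr_norml; lra.
Qed.

Section unit_interval.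
Variable R : realType.
Local Notation X := (unit_itv R).

Lemma unit_itv_bounds (c : X) : 0 <= val c <= 1.
Proof. by have := set_mem (valP c); rewrite /unit_itv /= in_itv. Qed.

Lemma nbhs_unit_itvP (c : X) (U : set X) : nbhs c U <->
  exists2 d : R, 0 < d & forall x : X, `|val c - val x| < d -> U x.
Proof.
split=> [/nbhs_ballP[d d0 dU]|[d d0 dU]]; first by exists d.
by apply/nbhs_ballP; exists d.
Qed.

Lemma compact_unit_itv : compact [set: X].
Proof.
move=> F FF _.
have [|p [p01 clp]] := @segment_compact R 0 1 (val @ F) _.
  by apply: (@filterE _ F) => x; exact: (set_mem (valP x)).
pose c : X := exist (fun x => x \in X) p (mem_set p01).
exists c; split=> // V U FV /nbhs_unit_itvP[d d0 dU].
have [||q [[x Vx <-] xd]] := clp (val @` V) (ball p d).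
- by apply: (@filterS _ F) FV => x Vx; exists x.
- exact: nbhsx_ballx.
- by exists x; split=> //; exact: dU.
Qed.

End unit_interval.

(** * Sets whose indicator lies in the ring *)

Section tame_sets.
Variable R : realType.
Local Notation X := (unit_itv R).
Implicit Types (E V W : set X) (c : X).

Definition tame_set E : Prop := (\1_E : X -> R) \in @Reg_circ_pred R.

Lemma tame_set0 : tame_set set0.
Proof.
rewrite /tame_set indic0.
have [R1 RB _] := Reg_circ_subring R.
have -> : cst 0 = (1 - 1 : X -> R) by rewrite subrr.
exact: RB.
Qed.

Lemma tame_setI V W : tame_set V -> tame_set W -> tame_set (V `&` W).
Proof.
rewrite /tame_set indicI => tV tW.
have [_ _ RM] := Reg_circ_subring R.
exact: RM.
Qed.

Lemma tame_setC V : tame_set V -> tame_set (~` V).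
Proof.
move=> tV; have [R1 RB _] := Reg_circ_subring R.
rewrite /tame_set; have -> : \1_(~` V) = 1 - \1_V :> (X -> R); last exact: RB.
apply/funext => x; rewrite indicC /= !fctE indicE.
by case: (x \in V); rewrite ?subrr ?subr0.
Qed.

Lemma tame_setU V W : tame_set V -> tame_set W -> tame_set (V `|` W).
Proof.
move=> tV tW; rewrite -[_ `|` _]setCK setCU.
by apply/tame_setC/tame_setI; exact: tame_setC.
Qed.

(** The position of x relative to a, below, at or above, is constant near every
    point other than a and on each side of a, so any set that it determines has
    at most one boundary point. Taking for S a set of signs gives the two open
    rays and the singleton. *)
Lemma tame_set_side (a : R) (S : set R) :
  tame_set [set x : X | S (Num.sg (val x - a))].
Proof.
set E := [set x | _].
have Ecvg (F : set_system X) (s : R) : Filter F ->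
    (\forall x \near F, Num.sg (val x - a) = s) ->
    \1_E x @[x --> F] --> (\1_S s : R).
  move=> FF Fs; apply: cvg_near_cst; apply: filterS Fs => x xs.
  rewrite !indicE; congr (_%:R); congr nat_of_bool.
  by apply/idP/idP => /set_mem Ex; apply/mem_set; rewrite /E /= ?xs // -xs.
apply/asboolP; split; first split=> c _.
- exists (\1_S (if val c < a then -1 else 1)); apply: Ecvg.
  case: ltP => ca.
    apply/nbhs_unit_itvP; exists (a - val c); first by rewrite subr_gt0.
    by move=> x xc /= cx; apply: ltr0_sg; move: ca xc; rewrite ltr_norml /=; lra.
  apply/nbhs_unit_itvP; exists 1 => // x xc /= cx.
  by apply: gtr0_sg; move: ca => /=; lra.
- exists (\1_S (if a < val c then 1 else -1)); apply: Ecvg.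
  case: ltP => ca.
    apply/nbhs_unit_itvP; exists (val c - a); first by rewrite subr_gt0.
    by move=> x xc /= cx; apply: gtr0_sg; move: ca xc; rewrite ltr_norml /=; lra.
  apply/nbhs_unit_itvP; exists 1 => // x xc /= cx.
  by apply: ltr0_sg; move: ca => /=; lra.
have Ects c : val c != a -> {for c, continuous (\1_E : X -> R)}.
  move=> ca; apply: (Ecvg (nbhs c) (Num.sg (val c - a))).
  apply/nbhs_unit_itvP; exists `|val c - a|; first by rewrite normr_gt0 subr_eq0.
  by move=> x; exact: sgr_subr_near.
apply: (@sub_finite_set _ _ (val @^-1` [set a])).
  by move=> c Nc; apply: contrapT => /eqP /Ects.
by apply: finite_preimage => // x y _ _; exact: val_inj.
Qed.

Lemma tame_gt (a : R) : tame_set [set x : X | a < val x].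
Proof.
have := tame_set_side a [set s | 0 < s].
by under eq_set do rewrite /= sgr_gt0 subr_gt0.
Qed.

Lemma tame_lt (a : R) : tame_set [set x : X | val x < a].
Proof.
have := tame_set_side a [set s | s < 0].
by under eq_set do rewrite /= sgr_lt0 subr_lt0.
Qed.

Lemma tame_set1 c : tame_set [set c].
Proof.
have := tame_set_side (val c) [set 0]; congr tame_set.
apply/seteqP; split => x /=; last by move=> ->; rewrite subrr sgr0.
by move=> /eqP; rewrite sgr_eq0 subr_eq0 => /eqP xc; exact: val_inj.
Qed.

End tame_sets.

(** * Separating low values from high values by a tame set *)

Section separation.
Variable R : realType.
Local Notation X := (unit_itv R).
Variable f : X -> R.
Implicit Types (V W : set X) (c : X).

(** The upper bound on E is imposed on all of E, not only on its part inside V: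
    this is what makes the property stable under unions. *)
Definition tamely_separated V : Prop := exists E : set X,
  [/\ tame_set E, forall x, E x -> f x < 3/4
    & forall x, V x -> ~ E x -> 1/4 < f x].

Lemma tamely_separated_sub V W : V `<=` W ->
  tamely_separated W -> tamely_separated V.
Proof. by move=> VW [E [tE El Eg]]; exists E; split=> // x /VW; exact: Eg. Qed.

Lemma tamely_separatedU V W :
  tamely_separated V -> tamely_separated W -> tamely_separated (V `|` W).
Proof.
move=> [D [tD Dl Dg]] [E [tE El Eg]]; exists (D `|` E); split.
- exact: tame_setU.
- by move=> x [/Dl|/El].
- by move=> x [/Dg + /not_orP[Dx Ex]|/Eg + /not_orP[Dx Ex]]; apply.
Qed.

(** As f stays within 1/4 of l on V, either f < 3/4 on all of V or 1/4 < f on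
    all of V, according to the side of 1/2 on which l lies; so E is V or empty. *)
Lemma tamely_separated_osc V (l : R) : tame_set V ->
  (forall x, V x -> `|l - f x| < 1/4) -> tamely_separated V.
Proof.
move=> tV Vl; have [l2|l2] := ltP l (1/2).
  exists V; split=> // x Vx.
  by have := Vl _ Vx; rewrite ltr_norml; lra.
exists set0; split=> //; first exact: tame_set0.
by move=> x Vx _; have := Vl _ Vx; rewrite ltr_norml; lra.
Qed.

Lemma tamely_separated_right c : has_right_lim f c ->
  exists2 d : R, 0 < d & tamely_separated [set x | val c < val x < val c + d].
Proof.
move=> [l /cvgrPdist_lt/(_ (1/4))].
have e0 : (0 : R) < 1/4 by lra.
move=> /(_ e0) /nbhs_unit_itvP[d d0 dl]; exists d => //.
apply: (tamely_separated_osc (l := l)).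
  have := tame_setI (tame_gt (val c)) (tame_lt (val c + d)); congr tame_set.
  by apply/seteqP; split => x /= => [[? ?]|/andP[? ?]//]; apply/andP.
move=> x /andP[cx xd]; apply: dl => //.
by rewrite distrC gtr0_norm ?subr_gt0// ltrBlDl.
Qed.

Lemma tamely_separated_left c : has_left_lim f c ->
  exists2 d : R, 0 < d & tamely_separated [set x | val c - d < val x < val c].
Proof.
move=> [l /cvgrPdist_lt/(_ (1/4))].
have e0 : (0 : R) < 1/4 by lra.
move=> /(_ e0) /nbhs_unit_itvP[d d0 dl]; exists d => //.
apply: (tamely_separated_osc (l := l)).
  have := tame_setI (tame_gt (val c - d)) (tame_lt (val c)); congr tame_set.
  by apply/seteqP; split => x /= => [[? ?]|/andP[? ?]//]; apply/andP.
move=> x /andP[xd cx]; apply: dl => //.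
by rewrite gtr0_norm ?subr_gt0// ltrBlDr -ltrBlDl.
Qed.

Hypothesis freg : regulated f.

(** A ball around c is the union of {c} and two one-sided intervals, each of
    small oscillation. At an end point of [0, 1] one of the intervals contains
    no point of [0, 1]. *)
Lemma tamely_separated_nbhs c : exists2 U, nbhs c U & tamely_separated U.
Proof.
have [fr fl] := freg.
have sep0 : tamely_separated set0.
  by exists set0; split=> //; exact: tame_set0.
have [r r0 sr] : exists2 d : R, 0 < d &
    tamely_separated [set x : X | val c < val x < val c + d].
  have [c1|c1] := ltP (val c) 1; first exact/tamely_separated_right/fr.
  exists 1 => //; apply: tamely_separated_sub sep0 => x /= /andP[cx _].
  have /andP[_ x1] := unit_itv_bounds x.
  by have := lt_le_trans cx (le_trans x1 c1); rewrite ltxx.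
have [d d0 sd] : exists2 d : R, 0 < d &
    tamely_separated [set x : X | val c - d < val x < val c].
  have [c0|c0] := ltP 0 (val c); first exact/tamely_separated_left/fl.
  exists 1 => //; apply: tamely_separated_sub sep0 => x /= /andP[_ xc].
  have /andP[x0 _] := unit_itv_bounds x.
  by have := lt_le_trans xc (le_trans c0 x0); rewrite ltxx.
have sc : tamely_separated [set c].
  apply: (tamely_separated_osc (l := f c)); first exact: tame_set1.
  by move=> _ ->; rewrite subrr normr0; lra.
exists [set x | `|val c - val x| < Num.min r d].
  by apply/nbhs_unit_itvP; exists (Num.min r d) => //; rewrite lt_min r0.
apply: tamely_separated_sub (tamely_separatedU sc (tamely_separatedU sr sd)).
move=> x; rewrite /= lt_min !ltr_norml ltrNl opprB.
move=> /andP[/andP[xr _] /andP[_ xd]].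
have [xc|cx|/val_inj ->] := ltgtP (val x) (val c); last by left.
  by right; right; apply/andP; split; rewrite // ltrBlDr -ltrBlDl; exact: xd.
by right; left; apply/andP; split; rewrite // -ltrBlDl; exact: xr.
Qed.

(** The complements of the separable sets form a filter. If [0, 1] were not
    separable, this filter would be proper and would cluster at some c, although
    the complement of a separable neighbourhood of c belongs to it. *)
Lemma regulated_tamely_separated : tamely_separated [set: X].
Proof.
apply: contrapT => Nsep.
have Fp : ProperFilter [set V | tamely_separated (~` V)].
  split; first by rewrite /= setC0.
  split.
  - rewrite /= setCT; exists set0; split=> //; exact: tame_set0.
  - by move=> V W sV sW; rewrite /mkset setCI; exact: tamely_separatedU.
  - by move=> V W VW; apply: tamely_separated_sub; exact: subsetC.
have [|c [_ clc]] := compact_unit_itv Fp; first exact: filterT.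
have [U cU sU] := tamely_separated_nbhs c.
have [|x [+ Ux]] := clc (~` U) U _ cU; first by rewrite /= setCK.
by apply.
Qed.

End separation.

(** * Cleanness of the ring *)

Section inverse.
Variable R : realType.
Local Notation X := (unit_itv R).

(** A zero limit is possible only along the improper filter, as g stays away
    from 0; then the inverse converges to everything. This spares a proof that
    the one-sided neighbourhood filters are proper. *)
Lemma cvgV_away0 (T : Type) (F : set_system T) (g : T -> R) (d l : R) :
  Filter F -> 0 < d -> (forall x, d <= `|g x|) -> g x @[x --> F] --> l ->
  exists m : R, (g x)^-1 @[x --> F] --> m.
Proof.
move=> FF d0 gd gl; have [l0|l0] := eqVneq l 0; last by exists l^-1; exact: cvgV.
exists 0; apply: cvg_near_cst.
move: gl => /cvgrPdist_lt/(_ d d0); apply: filterS => x.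
by rewrite l0 sub0r normrN ltNge gd.
Qed.

Lemma Reg_circ_predV (g : X -> R) (d : R) : 0 < d -> (forall x, d <= `|g x|) ->
  g \in @Reg_circ_pred R -> (fun x => (g x)^-1) \in @Reg_circ_pred R.
Proof.
move=> d0 gd /asboolP[[gr gl] gD]; apply/asboolP; split; first split=> c hc.
- by have [l /(cvgV_away0 _ d0 gd)] := gr c hc.
- by have [l /(cvgV_away0 _ d0 gd)] := gl c hc.
apply: sub_finite_set gD => c Nc gc; apply: Nc.
have gc0 : g c != 0 by rewrite -normr_gt0; exact: lt_le_trans (gd c).
exact: cvgV gc0 gc.
Qed.

Lemma Reg_circ_clean : clean_ring (Reg_circ R).
Proof.
move=> f; have /asboolP[freg _] := valP f.
have [E [tE El Eg]] := regulated_tamely_separated freg.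
pose e : Reg_circ R := exist (fun g => g \in @Reg_circ_pred R) _ tE.
have fe x : 1/4 <= `|val (f - e) x|.
  rewrite (_ : val (f - e) x = val f x - \1_E x) // indicE.
  rewrite ler_normr; have [/set_mem/El fx|/negP Ex] := boolP (x \in E).
    by apply/orP; right; rewrite mulr1n; lra.
  have fx : 1/4 < val f x by apply: Eg => // /mem_set.
  by apply/orP; left; rewrite mulr0n; lra.
have d0 : (0 : R) < 1/4 by lra.
pose u : Reg_circ R := exist (fun g => g \in @Reg_circ_pred R) _
  (Reg_circ_predV d0 fe (valP (f - e))).
exists e, u; split; apply: val_inj; apply/funext => x.
  by rewrite /= !fctE !indicE -natrM mulnb andbb.
rewrite (_ : val _ x = val (f - e) x * (val (f - e) x)^-1) // divff //.
by rewrite -normr_gt0; exact: lt_le_trans (fe x).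
Qed.

End inverse.

Theorem theorem5p5 (R : realType) : profinite_space (Specm (Reg_circ R)).
Proof. exact: clean_specm_profinite (@Reg_circ_clean R). Qed.
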